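(* Let $k\ge 2$ be an integer and let $\mathcal{A}_k$ denote the set of all binary (i.e., over the alphabet $\{0,1\}$) $k$-automatic infinite sequences. Then: (a) if $k$ is a power of $2$, then $\mathrm{rt}(\mathcal{A}_k)=2$; (b) if $k$ is not a power of $2$, then $\mathrm{rt}(\mathcal{A}_k)=7/3$.
   Context: For a finite word $w=w[1..n]$, an integer $p$ with $1\le p\le n$ is a period of $w$ if $w[i]=w[i+p]$ for $1\le i\le n-p$; the exponent of $w$ is $\exp(w)=n/p$ where $p$ is the smallest period of $w$. The critical exponent $\mathrm{ce}(\mathbf{x})$ of an infinite word $\mathbf{x}$ is the supremum of $\exp(w)$ over all finite nonempty factors $w$ of $\mathbf{x}$. For a nonempty set $S$ of infinite words, the repetition threshold $\mathrm{rt}(S)$ is the infimum of $\mathrm{ce}(\mathbf{x})$ over $\mathbf{x}\in S$. A sequence $(a_n)_{n\ge0}$ is $k$-automatic if there is a deterministic finite automaton with output which, on input the base-$k$ representation of $n$ (read most significant digit first), outputs $a_n$. *)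

(* Defs.v *)
From HB Require Import structures.
From mathcomp Require Import all_boot all_order all_algebra.
From mathcomp Require Import classical_sets reals ereal.
Set Implicit Arguments.
Unset Strict Implicit.
Unset Printing Implicit Defensive.
Import Order.TTheory GRing.Theory Num.Theory.
Local Open Scope classical_set_scope.
Local Open Scope ring_scope.

(* Positions are numbered from 0: [onth w i] is [Some] of the letter usually
   written w[i+1]. *)
Definition is_period (A : eqType) (w : seq A) (p : nat) : bool :=
  (1 <= p <= size w)%N &&
  [forall i : 'I_(size w - p), onth w i == onth w (i + p)%N].

(* For a nonempty word [size w] is itself a period, so that using it as the
   initial value does not affect the minimum. *)
Definition min_period (A : eqType) (w : seq A) : nat :=
  \big[minn/size w]_(1 <= p < (size w).+1 | is_period w p) p.

Definition exponent (R : realType) (A : eqType) (w : seq A) : R :=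
  (size w)%:R / (min_period w)%:R.

Definition is_factor (A : eqType) (w : seq A) (x : nat -> A) : Prop :=
  exists i : nat, w = mkseq (fun j => x (i + j)%N) (size w).

(* The value is +oo when the exponents of the factors are unbounded. *)
Definition critical_exponent (R : realType) (A : eqType) (x : nat -> A) :
    \bar R :=
  ereal_sup [set (exponent R w)%:E | w in
               [set w : seq A | w <> [::] /\ is_factor w x]].

Definition repetition_threshold (R : realType) (A : eqType)
    (S : set (nat -> A)) : \bar R :=
  ereal_inf [set critical_exponent R x | x in S].

Record dfao (k : nat) (A : Type) := Dfao {
  dfao_state : finType;
  dfao_init : dfao_state;
  dfao_step : dfao_state -> 'I_k -> dfao_state;
  dfao_label : dfao_state -> A
}.

Definition dfao_output (k : nat) (A : Type) (M : dfao k A) (s : seq 'I_k) : A :=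
  dfao_label (foldl (@dfao_step k A M) (dfao_init M) s).

(* [s] is the base-[k] representation of [n], most significant digit first and
   without leading zeros; 0 is represented by the empty word. *)
Definition is_base_repr (k : nat) (n : nat) (s : seq 'I_k) : Prop :=
  foldl (fun (v : nat) (d : 'I_k) => v * k + d)%N 0%N s = n /\
  (if s is d :: _ then (d : nat) <> 0%N else True).

(* For 2 <= k every [n] has exactly one base-[k] representation, so the
   universal quantifier over [s] merely names it. *)
Definition automatic (k : nat) (A : Type) : set (nat -> A) :=
  [set a | exists M : dfao k A,
     forall (n : nat) (s : seq 'I_k), is_base_repr n s -> dfao_output M s = a n].

(* Main.v *)
(* In a binary word [x] in which every
   repetition has exponent below 7/3, all occurrences of aa (away from the start)
   have the same parity, so [x] is, up to a short prefix, the Thue-Morse image of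
   a word with the same property. Iterating, equal factors of length 5 * 2 ^ s
   lie at positions that are congruent modulo 2 ^ s. In a [k]-automatic word two
   numbers a < b lead to the same state, so the factors of length k ^ m at
   a k ^ m and b k ^ m agree for all m; hence a fixed multiple of k ^ m is
   divisible by a power of 2 comparable to k ^ m, and k is a power of 2. This
   gives the lower bound 7/3, and Thue-Morse settles the powers of 2.

   For the upper bound 7/3 let N = k ^ 2. The N-uniform morphism that maps a
   letter a < 6 to the fixed prefix of length N - 3 of the ternary Thue word
   followed by a codeword of length 3 over {3, 4, 5} has a squarefree fixed
   point: a period of a square preserves the position of the codewords, and so
   is a multiple of N and yields a shorter square. A 26-uniform morphism, found
   by computer search, maps squarefree words over 6 letters to binary words all
   of whose repetitions have exponent at most 7/3. Its six blocks start with a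
   common marker that does not occur elsewhere, which makes long periods
   multiples of 26; and their prefixes, as well as their suffixes, of length 17
   are distinct, so that long repetitions come from squares. *)
Require Import Defs.
From HB Require Import structures.
From mathcomp Require Import all_boot all_order all_algebra.
From mathcomp Require Import boolp classical_sets reals ereal.
From mathcomp Require Import zify lra.
Set Implicit Arguments.
Unset Strict Implicit.
Unset Printing Implicit Defensive.
Import Order.TTheory GRing.Theory Num.Theory.
Local Open Scope classical_set_scope.
Local Open Scope ring_scope.

(** * Periods of factors and critical exponents *)

Local Open Scope nat_scope.

(* [x] has period [p] on the factor of length [p + r] at position [s]. *)
Definition matches (A : Type) (x : nat -> A) (s p r : nat) : Prop :=
  forall m, s <= m < s + r -> x m = x (m + p).

Definition squarefree (A : Type) (x : nat -> A) : Prop :=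
  forall s p, 0 < p -> ~ matches x s p p.

Definition overlap_free (A : Type) (x : nat -> A) : Prop :=
  forall s p, 0 < p -> ~ matches x s p p.+1.

Lemma matches_sub (A : Type) (x : nat -> A) s p r s' r' :
  s <= s' -> s' + r' <= s + r -> matches x s p r -> matches x s' p r'.
Proof. by move=> ? ? H m Hm; apply: H; lia. Qed.

Lemma is_periodP (A : eqType) (x : nat -> A) s n p :
  is_period (mkseq (fun j => x (s + j)) n) p <->
  1 <= p <= n /\ matches x s p (n - p).
Proof.
rewrite /is_period size_mkseq; split.
  case/andP=> Hp /forallP H; split=> // m Hm.
  have Hi : m - s < n - p by lia.
  have := H (Ordinal Hi); rewrite /= !onthE.
  rewrite !(nth_map (x 0)) ?size_mkseq ?nth_mkseq; try lia.
  rewrite !addnA subnKC; last by lia.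
  by case/eqP.
case=> Hp H; rewrite Hp; apply/forallP=> -[i Hi] /=; rewrite !onthE.
rewrite !(nth_map (x 0)) ?size_mkseq ?nth_mkseq; try lia.
by apply/eqP; congr Some; rewrite addnA; apply: H; lia.
Qed.

Lemma is_period_size (A : eqType) (w : seq A) : w <> [::] -> is_period w (size w).
Proof.
move=> Hw; rewrite /is_period leqnn andbT lt0n size_eq0; apply/andP; split.
  exact/eqP.
by apply/forallP=> -[i]; rewrite subnn.
Qed.

Lemma min_period_is_period (A : eqType) (w : seq A) :
  w <> [::] -> is_period w (min_period w).
Proof.
move=> Hw; rewrite /min_period; apply: (big_ind (fun q => is_period w q)) => //.
  exact: is_period_size.
by move=> a b Ha Hb; rewrite /minn; case: ifP.
Qed.

Lemma min_period_le (A : eqType) (w : seq A) p :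
  is_period w p -> min_period w <= p.
Proof.
move=> Hp; have /andP[/andP[p1 p2] _] := Hp.
have: p \in index_iota 1 (size w).+1 by rewrite mem_index_iota; lia.
rewrite /min_period; elim: (index_iota _ _) => // q r IH.
rewrite inE big_cons => /predU1P[<-|/IH]; first by rewrite Hp geq_minl.
by case: ifP => // _; apply: leq_trans; exact: geq_minr.
Qed.

Section CriticalExponent.
Variables (R : realType) (A : eqType) (x : nat -> A).
Local Open Scope ring_scope.

Lemma critical_exponent_le (c : R) :
  (forall s p r, (0 < p)%N -> matches x s p r -> (p + r)%:R <= c * p%:R) ->
  (critical_exponent R x <= c%:E)%E.
Proof.
move=> H; apply: ge_ereal_sup => _ [w [Hw [i Ew]] <-].
have := min_period_is_period Hw.
rewrite {1}Ew => /is_periodP [/andP[p1 p2] Hm].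
rewrite lee_fin /exponent ler_pdivrMr ?ltr0n //.
by have := H _ _ _ p1 Hm; rewrite subnKC.
Qed.

Lemma critical_exponent_ge s p r :
  (0 < p)%N -> matches x s p r ->
  (((p + r)%:R / p%:R : R)%:E <= critical_exponent R x)%E.
Proof.
move=> Hp Hm; set w := mkseq (fun j => x (s + j)%N) (p + r).
have Hw : w <> [::] by move/(congr1 size); rewrite size_mkseq /=; lia.
have Hper : is_period w p.
  by apply/is_periodP; split; [lia | rewrite addKn].
apply: le_trans (_ : (exponent R w)%:E <= _)%E; last first.
  by apply: ereal_sup_ubound; exists w => //; split=> //; exists s; rewrite size_mkseq.
rewrite lee_fin /exponent size_mkseq ler_wpM2l // lef_pV2 ?posrE ?ltr0n //.
  by rewrite ler_nat min_period_le.
by have /andP[/andP[]] := min_period_is_period Hw.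
Qed.

End CriticalExponent.

(** * The words of Thue *)

Section FixedPoint.
Variables (A : Type) (N : nat) (h : A -> nat -> A) (a0 : A).

Fixpoint morphic_fuel f n :=
  if f is f'.+1 then
    if n == 0 then a0 else h (morphic_fuel f' (n %/ N)) (n %% N)
  else a0.

(* The fixed point, with first letter [a0], of the [N]-uniform morphism that
   maps [a] to [h a 0 ... h a (N - 1)]. *)
Definition morphic n := morphic_fuel n n.

Hypotheses (N_gt1 : 1 < N) (h_a0 : h a0 0 = a0).

Lemma morphic_fuelE f n : n <= f -> morphic_fuel f n = morphic n.
Proof.
suff H g : n <= f -> n <= g -> morphic_fuel f n = morphic_fuel g n.
  by move=> Hn; apply: H.
elim: f g n => [|f IH] [|g] [|n] //= Hf Hg; congr (h _ _).
have Hd : n.+1 %/ N < n.+1 by rewrite ltn_Pdiv.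
by apply: IH; lia.
Qed.

Lemma morphicE n r : r < N -> morphic (N * n + r) = h (morphic n) r.
Proof.
move=> Hr; have [m Hm] : exists m, N * n + r <= m.+1 by exists (N * n + r).
rewrite -(morphic_fuelE Hm) /=; case: eqP => [E|_].
  have [-> ->] : n = 0 /\ r = 0 by nia.
  by rewrite h_a0.
rewrite mulnC divnMDl 1?modnMDl ?modn_small ?divn_small ?addn0; try lia.
by rewrite morphic_fuelE //; nia.
Qed.

End FixedPoint.

Definition thue_morse : nat -> bool := morphic 2 (fun a r => a (+) odd r) false.

Lemma thue_morse_even n : thue_morse (2 * n) = thue_morse n.
Proof. by rewrite -(addn0 (2 * n)) /thue_morse morphicE // addbF. Qed.

Lemma thue_morse_odd n : thue_morse (2 * n + 1) = ~~ thue_morse n.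
Proof. by rewrite /thue_morse morphicE // addbT. Qed.

Lemma thue_morse_double m : thue_morse m = thue_morse m.+1 -> odd m.
Proof.
move=> E; apply/negbNE/negP=> Ho.
have [Em EmS] : m = 2 * m./2 /\ m.+1 = 2 * m./2 + 1 by lia.
by move: E; rewrite EmS {1}Em thue_morse_even thue_morse_odd; case: thue_morse.
Qed.

Lemma thue_morse_double_exists m :
  exists2 i, m <= i < m + 4 & thue_morse i = thue_morse i.+1.
Proof.
pose n := (m + 2) %/ 4; exists (4 * n + 1); first by rewrite /n; lia.
have [-> ->] : 4 * n + 1 = 2 * (2 * n) + 1 /\ (4 * n + 1).+1 = 2 * (2 * n + 1) by lia.
by rewrite thue_morse_odd !thue_morse_even thue_morse_odd.
Qed.

(** An even period can be halved by passing to the letters at even or at odd positions. An odd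
    period moves a pair of equal adjacent letters to a position of the other parity, against
    [thue_morse_double]. *)
Lemma thue_morse_overlap_free : overlap_free thue_morse.
Proof.
move=> s p; elim/ltn_ind: p s => p IH s Hp H.
case: (boolP (odd p)) => Ho; last first.
  have [q Eq] : exists q, p = 2 * q by exists p./2; lia.
  apply: (IH q _ s./2) => [||j Hj]; try lia.
  case: (boolP (odd s)) => Hs.
    apply: negb_inj; rewrite -!thue_morse_odd H; last by lia.
    by congr thue_morse; lia.
  rewrite -!(thue_morse_even j) H; last by lia.
  by rewrite Eq -(thue_morse_even (j + q)); congr thue_morse; lia.
have no_double i : s <= i < s + p -> thue_morse i <> thue_morse i.+1.
  move=> Hi E; have : thue_morse (i + p) = thue_morse (i + p).+1.
    by rewrite -addSn -(H i) -1?(H i.+1) //; lia.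
  by move/thue_morse_double; have := thue_morse_double E; lia.
have [p1|p2] : p = 1 \/ 1 < p by lia.
  by apply: (no_double s); [lia | rewrite H p1 ?addn1 //; lia].
have [i Hi E] := thue_morse_double_exists s.
have [Hip|Hip] : i < s + p \/ s + p <= i by lia.
  by apply: (no_double i) => //; lia.
apply: (no_double (i - p)); first by lia.
rewrite (H (i - p)) ?(H (i - p).+1); try lia.
by rewrite addSn subnK //; lia.
Qed.

Definition vtm n : nat := thue_morse n.+1 + ~~ thue_morse n.

Lemma vtm_lt3 n : vtm n < 3.
Proof. by rewrite /vtm; do 2 case: thue_morse. Qed.

(* [vtm n - 1] is the difference of consecutive letters of [thue_morse], and so
   the sum of a block of [vtm] determines the difference of the Thue-Morse
   letters at its two ends. Two equal adjacent blocks have equal differences,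
   which are then zero, since otherwise a bit would change by 2. *)
Lemma vtm_squarefree : squarefree vtm.
Proof.
move=> s p Hp H.
have T i : i <= p ->
    thue_morse (s + i) + thue_morse (s + p) = thue_morse (s + p + i) + thue_morse s.
  elim: i => [|i IH] Hi; first by rewrite !addn0 addnC.
  have Hsi : s <= s + i < s + p by lia.
  have := H _ Hsi; rewrite /vtm (addnAC s i p) -!addnS.
  have := IH (ltnW Hi).
  by do 6 case: thue_morse.
have E : thue_morse (s + p) = thue_morse s.
  by have := T p (leqnn p); do 3 case: thue_morse.
apply: (thue_morse_overlap_free (s := s) Hp) => m Hm.
have Hms : m - s <= p by lia.
have := T _ Hms; rewrite E (_ : s + p + (m - s) = m + p) ?subnKC; lia.
Qed.

(** * Automatic words *)

Lemma automatic_of_step k (A : Type) (T : finType) (z : nat -> T)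
    (step : T -> 'I_k -> T) (out : T -> A) :
  (forall n (d : 'I_k), z (n * k + d) = step (z n) d) ->
  @automatic k A (out \o z).
Proof.
move=> H; exists (Dfao (z 0) step out) => n s [<- _].
rewrite /dfao_output /=; congr out.
elim: s 0 => //= d s IH v.
by rewrite -H IH.
Qed.

Lemma thue_morse_block m n d :
  d < 2 ^ m -> thue_morse (n * 2 ^ m + d) = thue_morse n (+) thue_morse d.
Proof.
elim: m n d => [|m IH] n d; rewrite ?expnS.
  by rewrite expn0 ltnS leqn0 => /eqP ->; rewrite muln1 addn0 addbF.
move=> Hd; case: (boolP (odd d)) => Ho.
  have [E1 E2] : d = 2 * d./2 + 1 /\
      n * (2 * 2 ^ m) + d = 2 * (n * 2 ^ m + d./2) + 1 by nia.
  by rewrite E2 {2}E1 !thue_morse_odd IH ?addbN //; lia.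
have [E1 E2] : d = 2 * d./2 /\
    n * (2 * 2 ^ m) + d = 2 * (n * 2 ^ m + d./2) by nia.
by rewrite E2 {2}E1 !thue_morse_even IH //; lia.
Qed.

Lemma thue_morse_automatic m : @automatic (2 ^ m) bool thue_morse.
Proof.
apply: (@automatic_of_step _ _ _ thue_morse
          (fun a (d : 'I_(2 ^ m)) => a (+) thue_morse d) id) => n d.
exact: thue_morse_block.
Qed.

Section Digits.
Variable k : nat.
Hypothesis k_gt1 : 1 < k.
Let k_gt0 : 0 < k := ltnW k_gt1.

Let value := foldl (fun (v : nat) (d : 'I_k) => v * k + d).

Lemma digits_exist m c :
  c < k ^ m -> exists e : seq 'I_k, forall v, value v e = v * k ^ m + c.
Proof.
elim: m c => [|m IH] c Hc.
  by exists [::] => v /=; move: Hc; rewrite expn0; lia.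
have Hq : c %/ k < k ^ m by rewrite ltn_divLR // mulnC -expnS.
have [e He] := IH _ Hq.
exists (rcons e (Ordinal (ltn_pmod c k_gt0))) => v.
rewrite /value foldl_rcons -/value He /= expnS.
by rewrite {3}(divn_eq c k); lia.
Qed.

Lemma base_repr_exists n : exists s : seq 'I_k, is_base_repr n s.
Proof.
elim/ltn_ind: n => n IH; have [->|n0] := posnP n; first by exists [::].
have [s [Hs Hh]] := IH _ (ltn_Pdiv k_gt1 n0).
exists (rcons s (Ordinal (ltn_pmod n k_gt0))); split.
  by rewrite foldl_rcons Hs /= -divn_eq.
case: s Hs Hh => [|d s] //= Hs _.
by move: (divn_eq n k); lia.
Qed.

Lemma automatic_repetition (A : Type) (x : nat -> A) :
  @automatic k A x ->
  exists a b, 0 < a < b /\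
    forall m c, c < k ^ m -> x (a * k ^ m + c) = x (b * k ^ m + c).
Proof.
case=> M HM; have [repr Hr] := choice base_repr_exists.
pose st n := foldl (@dfao_step k A M) (dfao_init M) (repr n).
(* The suffix [e] serves every [n'] at once; positivity keeps the leading digit nonzero. *)
have ext n m c : 0 < n -> c < k ^ m -> exists e : seq 'I_k, forall n', 0 < n' ->
    is_base_repr (n' * k ^ m + c) (repr n' ++ e).
  move=> n0 /digits_exist [e He]; exists e => n' n'0.
  have [Hv Hh] := Hr n'; split; first by rewrite foldl_cat Hv -/value He.
  by case: (repr n') Hv Hh => [|d s] //=; lia.
have [i [j [ij Eij]]] : exists i j, i < j /\ st i.+1 = st j.+1.
  pose f (i : 'I_(#|dfao_state M|.+1)) := st i.+1.
  have /injectivePn [i [j ij Eij]] : ~~ injectiveb f.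
    apply/injectiveP => /leq_card; rewrite card_ord.
    by rewrite ltnn.
  have [lt|lt|/val_inj E] := ltngtP i j.
  - by exists i, j.
  - by exists j, i.
  - by rewrite E eqxx in ij.
exists i.+1, j.+1; split=> // m c Hc.
have [e He] := ext 1 m c isT Hc.
have st_out n : x (n.+1 * k ^ m + c) = dfao_label (foldl (@dfao_step k A M) (st n.+1) e).
  by rewrite -(HM _ _ (He n.+1 isT)) /dfao_output foldl_cat.
by rewrite !st_out Eij.
Qed.

End Digits.

(** * Binary words without repetitions of exponent 7/3 *)

(** [3 * r < 4 * p] says that the exponent [(p + r) / p] is below 7/3. *)
Definition lt73_free (x : nat -> bool) : Prop :=
  forall s p r, 0 < p -> matches x s p r -> 3 * r < 4 * p.

Section SubcriticalStructure.
Variable x : nat -> bool.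
Hypothesis x_free : lt73_free x.

Let free_at s p r :
  0 < p -> 4 * p <= 3 * r -> exists2 m, s <= m < s + r & x (m + p) = ~~ x m.
Proof.
move=> p0 Hr; apply: contrapT => H.
have /(x_free p0) : matches x s p r; last by lia.
move=> m Hm; apply: contrapT => E; apply: H; exists m => //.
by move: E; do 2 case: x.
Qed.

(** Five alternating letters have exponent 5/2. *)
Lemma lt73_free_double_exists s :
  exists2 i, s <= i < s + 4 & x i = x i.+1.
Proof.
apply: contrapT => H.
have {}H i : s <= i < s + 4 -> x i.+1 = ~~ x i.
  move=> Hi; case E : (x i.+1 == ~~ x i); first exact/eqP.
  case: H; exists i => //; move/eqP: E; by do 2 case: x.
have [//|//|m Hm] := @free_at s 2 3.
by rewrite addn2 !H; lia.
Qed.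

(** Induction on an odd distance between two doubles. Distance 1 is a cube; distance 3 forces, with
    both neighbours, the word baabaab of exponent 7/3; a larger distance is split by an intermediate
    double, and one of its parts is odd. The letter before the first double is used, hence positive
    positions. *)
Lemma lt73_free_double_parity i j :
  0 < i -> 0 < j -> x i = x i.+1 -> x j = x j.+1 -> odd i = odd j.
Proof.
have cube n : x n = x n.+1 -> x n.+2 = ~~ x n.
  move=> E; have [//|//|m Hm] := @free_at n 1 2; rewrite addn1.
  have [->|->] : m = n \/ m = n.+1 by lia.
    by rewrite -E; case: (x n).
  by rewrite -E.
have odd_gap d n : 0 < n -> x n = x n.+1 -> x (n + (2 * d).+1) = x (n + (2 * d).+1).+1 -> False.
  elim/ltn_ind: d n => -[|[|d]] IH n n0 En.
  - by rewrite addn1 => E; have := cube _ En; rewrite -E -En; case: (x n).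
  - rewrite (_ : n + _ = n.+3) => [E3|]; last by lia.
    have E2 := cube _ En.
    have Ep : x n.-1 = ~~ x n.
      case E : (x n.-1 == x n); last by move/eqP: E; do 2 case: x.
      have := cube n.-1; rewrite prednK // (eqP E) => /(_ erefl).
      by rewrite -En; case: (x n).
    have E5 := cube _ E3.
    have E3' : x n.+3 = x n.
      case E : (x n.+3 == x n.+2); last by move: E; rewrite E2; do 2 case: x.
      by have := cube n.+2; rewrite (eqP E) => /(_ erefl); rewrite -E3 (eqP E) E2; case: (x n).
    have [//|//|m Hm] := @free_at n.-1 3 4.
    have [->|[->|[->|->]]] : m = n.-1 \/ m = n \/ m = n.+1 \/ m = n.+2 by lia.
    + by rewrite (_ : n.-1 + 3 = n.+2) ?E2 ?Ep; [case: (x n) | lia].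
    + by rewrite addn3 E3'; case: (x n).
    + by rewrite addn3 -E3 E3' -En; case: (x n).
    + by rewrite addn3 E5 E3' E2; case: (x n).
  have [l Hl El] := lt73_free_double_exists n.+1.
  move=> Ej; case: (boolP (odd (l - n))) => Ho.
    apply: (IH (l - n)./2 _ n) => //; first by lia.
    by rewrite (_ : n + _ = l) //; lia.
  apply: (IH (d.+2 - (l - n)./2) _ l) => //; try lia.
  by rewrite (_ : l + _ = n + (2 * d.+2).+1) //; lia.
move=> i0 j0 Ei Ej; apply: contrapT => Hij.
have [lt|le] := ltnP i j.
  apply: (odd_gap (j - i)./2 i) => //.
  by rewrite (_ : i + _ = j) //; lia.
apply: (odd_gap (i - j)./2 j) => //.
by rewrite (_ : j + _ = i) //; lia.
Qed.

(* The blocks [x (e + 2 n) x (e + 2 n + 1)] are 01 or 10, so that behind a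
   prefix of length [e] the word [x] is the image under the Thue-Morse morphism
   of its subword considered here. *)
Lemma lt73_free_desubst :
  exists2 e, 1 <= e <= 2 & lt73_free (fun n => x (e + 2 * n)).
Proof.
have [i Hi Ei] := lt73_free_double_exists 1.
pose e := if odd i then 2 else 1.
have [He Hodd] : 1 <= e <= 2 /\ odd e = ~~ odd i.
  by rewrite /e; case: (odd i).
exists e => // s p r p0 H.
have no_double n : x (e + 2 * n + 1) = ~~ x (e + 2 * n).
  case E : (x (e + 2 * n) == x (e + 2 * n + 1)); last first.
    by move/eqP: E; do 2 case: x.
  move/eqP: E; rewrite addn1 => E.
  have [i0 en0] : 0 < i /\ 0 < e + 2 * n by lia.
  by have := lt73_free_double_parity i0 en0 Ei E; lia.
suff : matches x (e + 2 * s) (2 * p) (2 * r).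
  by move/x_free => H'; have := H' _; lia.
move=> m Hm; pose n := (m - e)./2.
case: (boolP (odd (m - e))) => Ho.
  have [-> ->] : m = e + 2 * n + 1 /\ e + 2 * n + 1 + 2 * p = e + 2 * (n + p) + 1.
    by rewrite /n; lia.
  by rewrite !no_double (H n) // /n; lia.
have [-> ->] : m = e + 2 * n /\ e + 2 * n + 2 * p = e + 2 * (n + p).
  by rewrite /n; lia.
by rewrite (H n) // /n; lia.
Qed.

End SubcriticalStructure.

(** Five letters contain a double, so [i] and [j] have equal parity; then the preimages under the
    Thue-Morse morphism are compared. The bound on [i + 2] leaves room for the dropped prefixes:
    [2 * (n + 2) = i + d + 4 - e >= i + 2]. *)
Lemma lt73_free_sync s x i j :
  lt73_free x -> 2 ^ s.+1 <= i + 2 -> 2 ^ s.+1 <= j + 2 ->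
  (forall c, c < 5 * 2 ^ s -> x (i + c) = x (j + c)) -> i = j %[mod 2 ^ s].
Proof.
elim: s x i j => [|s IH] x i j Hx; first by rewrite expn0 !modn1.
rewrite !(expnS 2 s.+1) !(expnS 2 s) => Hi Hj H.
have s0 : 0 < 2 ^ s by rewrite expn_gt0.
have par : odd i = odd j.
  have [l Hl El] := lt73_free_double_exists Hx i.
  have E' : x (j + (l - i)) = x (j + (l - i)).+1.
    by rewrite -addnS -!H ?addnS ?subnKC //; lia.
  have [l0 l0'] : 0 < l /\ 0 < j + (l - i) by lia.
  by have := lt73_free_double_parity Hx l0 l0' El E'; lia.
have [e He Hx'] := lt73_free_desubst Hx.
pose d := (i + e) %% 2.
have [n En] : exists n, i + d = e + 2 * n by exists ((i + d - e)./2); rewrite /d; lia.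
have [n' En'] : exists n', j + d = e + 2 * n' by exists ((j + d - e)./2); rewrite /d; lia.
have d1 : d < 2 by rewrite ltn_mod.
have : n = n' %[mod 2 ^ s].
  apply: (IH _ _ _ Hx') => //; rewrite ?expnS; try lia.
  move=> c Hc; rewrite (_ : e + 2 * (n + c) = i + (d + 2 * c)); last by lia.
  by rewrite H; [congr x; lia | lia].
move=> Hn; apply/eqP; rewrite -(eqn_modDr d) En En' eqn_modDl.
by rewrite -!muln_modr Hn.
Qed.

Lemma automatic_lt73_free k x :
  1 < k -> @automatic k bool x -> lt73_free x -> exists e, k = 2 ^ e.
Proof.
move=> k1 /(automatic_repetition k1) [a [b [ab Hab]]] Hx.
have k0 : 0 < k by lia.
have [o o_odd Ek] := pfactor_coprime (isT : prime 2) k0.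
set e := logn 2 k in Ek; exists e.
have [o1|o1] := leqP o 1.
  by rewrite Ek (_ : o = 1) ?mul1n //; case: o o1 o_odd Ek => [|[]].
(* For the largest [2 ^ s] with [5 * 2 ^ s <= k ^ m], synchronization yields
   [2 ^ s <= (b - a) * 2 ^ (e * m)]. As [k ^ m < 10 * 2 ^ s], this gives [o ^ m < 10 * (b - a)],
   which this [m] excludes. *)
pose m := 10 * (b - a) + 3.
have m_lt_om : m < o ^ m by rewrite ltn_expl.
have EK : k ^ m = o ^ m * 2 ^ (e * m) by rewrite {1}Ek expnMn expnM.
have HK : m < k ^ m by rewrite ltn_expl.
have /andP[s1 s2] : 2 ^ trunc_log 2 (k ^ m %/ 5) <= k ^ m %/ 5
    < 2 ^ (trunc_log 2 (k ^ m %/ 5)).+1 by apply: trunc_log_bounds => //; lia.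
set s := trunc_log _ _ in s1 s2; rewrite !expnS in s2.
have Hsync : a * k ^ m = b * k ^ m %[mod 2 ^ s].
  have Ha n : 0 < n -> 2 ^ s.+1 <= n * k ^ m + 2.
    by move=> n0; have := leq_pmull (k ^ m) n0; rewrite expnS; lia.
  apply: (lt73_free_sync Hx) => [||c Hc]; [apply: Ha; lia.. | apply: Hab; lia].
have : 2 ^ s %| (b - a) * 2 ^ (e * m).
  rewrite -(@Gauss_dvdr _ (o ^ m)); last by rewrite coprimeXl // coprimeXr.
  have -> : o ^ m * ((b - a) * 2 ^ (e * m)) = (b - a) * k ^ m by rewrite EK; lia.
  by rewrite mulnBl -eqn_mod_dvd ?Hsync // leq_mul2r ltnW ?orbT //; case/andP: ab.
have e0 : 0 < 2 ^ (e * m) by rewrite expn_gt0.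
move/dvdn_leq; rewrite muln_gt0 e0 subn_gt0; case/andP: ab => _ -> /(_ isT) Hle.
have : o ^ m * 2 ^ (e * m) < 10 * (b - a) * 2 ^ (e * m).
  by rewrite -EK -mulnA; lia.
by rewrite ltn_pmul2r //; lia.
Qed.

(** Four binary letters contain aa or are abab. *)
Lemma critical_exponent_ge2 (R : realType) (x : nat -> bool) :
  ((2%:R : R)%:E <= critical_exponent R x)%E.
Proof.
have [s [p [p0 H]]] : exists s p, 0 < p /\ matches x s p p.
  have [E|E0] := eqVneq (x 0) (x 1).
    by exists 0, 1; split=> // -[].
  have [E|E1] := eqVneq (x 1) (x 2).
    by exists 1, 1; split=> // -[|[]].
  have [E|E2] := eqVneq (x 2) (x 3).
    by exists 2, 1; split=> // -[|[|[]]].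
  exists 0, 2; split=> // -[|[|//]] _.
    by move: E0 E1; do 3 case: (x _).
  by move: E1 E2; do 3 case: (x _).
apply: le_trans (critical_exponent_ge R p0 H).
by rewrite lee_fin ler_pdivlMr ?ltr0n // -natrM ler_nat; lia.
Qed.

Lemma lt73_free_of_critical_exponent (R : realType) (x : nat -> bool) :
  (critical_exponent R x < ((7 / 3)%R : R)%:E)%E -> lt73_free x.
Proof.
move=> Hx s p r p0 H.
have := le_lt_trans (critical_exponent_ge R p0 H) Hx.
rewrite lte_fin ltr_pdivrMr ?ltr0n // => Hlt.
have : ((3 * (p + r))%:R < (7 * p)%:R :> R)%R by rewrite !natrM; lra.
by rewrite ltr_nat; lia.
Qed.

(** * A squarefree word generated by a uniform morphism *)

(** The six words aba with distinct a, b in {3, 4, 5}. *)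
Definition code (a : nat) : seq nat :=
  nth [::] [:: [:: 3; 4; 3]; [:: 3; 5; 3]; [:: 4; 3; 4];
               [:: 4; 5; 4]; [:: 5; 3; 5]; [:: 5; 4; 5]] a.

Lemma code_range a i : a < 6 -> i < 3 -> 3 <= nth 0 (code a) i < 6.
Proof. by do 6 (case: a => [|a] //; first by case: i => [|[|[|]]]). Qed.

Lemma code_adjacent a i : a < 6 -> i < 2 -> nth 0 (code a) i != nth 0 (code a) i.+1.
Proof. by do 6 (case: a => [|a] //; first by case: i => [|[|]]). Qed.

(* Two adjacent letters determine a codeword, and so at any place at which a
   codeword is cut one of its two parts determines it. *)
Lemma code_inj a b i :
  a < 6 -> b < 6 -> i < 2 ->
  nth 0 (code a) i = nth 0 (code b) i ->
  nth 0 (code a) i.+1 = nth 0 (code b) i.+1 -> a = b.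
Proof.
do 6 (case: a => [|a] //; first by case: i => [|[|]] //; do 6 (case: b => [|b] //)).
Qed.

Section Squarefree.
Variable K : nat.
Hypothesis K_gt0 : 0 < K.
Let N := K + 3.

Definition sqf_morphism (a r : nat) : nat :=
  if r < K then vtm r else nth 0 (code a) (r - K).

(** The first letter is 2 because [vtm 0 = 2]. *)
Definition sqf_word : nat -> nat := morphic N sqf_morphism 2.

Let y := sqf_word.

Lemma sqf_wordE n r : r < N -> y (N * n + r) = sqf_morphism (y n) r.
Proof.
by apply: morphicE; rewrite /sqf_morphism ?K_gt0 // /N; lia.
Qed.

Lemma sqf_morphism_lt6 a r : a < 6 -> r < N -> sqf_morphism a r < 6.
Proof.
move=> Ha; rewrite /sqf_morphism /N; case: ifP => Hr HN.
  by have := vtm_lt3 r; lia.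
have Hi : r - K < 3 by lia.
by have := code_range Ha Hi; lia.
Qed.

Lemma sqf_word_lt6 n : y n < 6.
Proof.
elim/ltn_ind: n => n IH; have [->|n0] := posnP n; first by [].
have N1 : 1 < N by rewrite /N; lia.
have HN : n %% N < N by rewrite ltn_mod; lia.
rewrite (divn_eq n N) mulnC sqf_wordE //.
by apply: sqf_morphism_lt6 => //; apply: IH; apply: ltn_Pdiv.
Qed.

Lemma sqf_word_vtm n r : r < K -> y (N * n + r) = vtm r.
Proof. by move=> Hr; rewrite sqf_wordE /sqf_morphism ?Hr // /N; lia. Qed.

Lemma sqf_word_code n i : i < 3 -> y (N * n + K + i) = nth 0 (code (y n)) i.
Proof.
move=> Hi; rewrite -addnA sqf_wordE /sqf_morphism; last by rewrite /N; lia.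
by rewrite ltnNge leq_addr addKn.
Qed.

Lemma sqf_word_high n r : r < N -> (3 <= y (N * n + r)) = (K <= r).
Proof.
move=> Hr; case: (ltnP r K) => HK.
  by rewrite sqf_word_vtm // leqNgt vtm_lt3.
have Hi : r - K < 3 by move: Hr; rewrite /N; lia.
rewrite (_ : N * n + r = N * n + K + (r - K)); last by lia.
by rewrite sqf_word_code //; have := code_range (sqf_word_lt6 n) Hi; lia.
Qed.

Lemma sqf_word_desubst s q :
  matches y s (N * q) (N * q) -> exists s', matches y s' q q.
Proof.
move=> H; pose j := s %/ N; pose e := s %% N.
have N0 : 0 < N by rewrite /N; lia.
have Es : s = N * j + e by rewrite mulnC; exact: divn_eq.
have He : e < N by rewrite ltn_mod.
have step i n : i < 2 -> s <= N * n + K + i -> N * n + K + i.+1 < s + N * q ->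
    y n = y (n + q).
  move=> Hi Hs Hsq.
  have C i' : i <= i' <= i.+1 ->
      nth 0 (code (y n)) i' = nth 0 (code (y (n + q))) i'.
    move=> Hi'; rewrite -!sqf_word_code; try lia.
    by rewrite H; [congr y; rewrite mulnDr; lia | lia].
  by apply: (code_inj (i := i)); rewrite ?sqf_word_lt6 ?C //; lia.
(* If at least two letters of the codeword of block [j] remain, its last two are compared; otherwise
   its first two, from block [j.+1] on. *)
have [Hk|Hk] := leqP e K.+1.
  exists j => n Hn; apply: (step 1) => //; first by nia.
  by move: He Es; rewrite /N; nia.
exists j.+1 => n Hn; apply: (step 0) => //; first by move: He Es; rewrite /N; nia.
by move: He Es; rewrite /N; nia.
Qed.

(** Letters at least 3 fill exactly the last three places of each block. A shift by a nonzero
    residue [d] moves place [K.-1] onto one of them if [d <= 3], and place [K] off them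
    otherwise. *)
Lemma sqf_word_long_period s p :
  matches y s p p -> N <= p -> exists q, p = N * q.
Proof.
move=> H Hp; pose d := p %% N; pose q := p %/ N.
have Ep : p = N * q + d by rewrite mulnC; exact: divn_eq.
have Hd : d < N by rewrite ltn_mod /N; lia.
have T r : r < N -> exists n, (K <= r) = (3 <= y (N * (n + q) + (r + d))).
  move=> Hr; have Hsr : s < N * s.+1 by rewrite /N; lia.
  pose n := (s + N - 1 - r) %/ N.
  have Hn : s <= N * n + r < s + N.
    have := divn_eq (s + N - 1 - r) N; rewrite -/n.
    have : (s + N - 1 - r) %% N < N by rewrite ltn_mod /N; lia.
    by lia.
  exists n; rewrite -(sqf_word_high n Hr) H; last by lia.
  by rewrite Ep; congr (3 <= y _); lia.
have [d0|d0] := posnP d; first by exists q; lia.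
have [d3|d3] := leqP d 3.
  have [|n] := T K.-1; first by rewrite /N; lia.
  by rewrite sqf_word_high; rewrite /N; lia.
have [|n] := T K; first by rewrite /N; lia.
rewrite (_ : _ + (K + d) = N * (n + q).+1 + (d - 3)) ?sqf_word_high; rewrite /N in Hd *; lia.
Qed.

(** A square inside one prefix or one codeword is excluded by [vtm_squarefree] or [code_adjacent];
    any other would match a letter below 3 with one at least 3. *)
Lemma sqf_word_short_period s p : 0 < p -> matches y s p p -> N <= p.
Proof.
move=> p0 H; rewrite leqNgt; apply/negP => pN.
pose j := s %/ N; pose e := s %% N.
have N0 : 0 < N by rewrite /N; lia.
have Es : s = N * j + e by rewrite mulnC; exact: divn_eq.
have He : e < N by rewrite ltn_mod.
pose J := N * j.
have hiA r : r < N -> (3 <= y (J + r)) = (K <= r) by exact: sqf_word_high.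
have hiB r : r < N -> (3 <= y (J + N + r)) = (K <= r).
  by rewrite /J -mulnSr; exact: sqf_word_high.
have hiH m : s <= m < s + p -> (3 <= y m) = (3 <= y (m + p)) by move/H=> ->.
rewrite -/J in Es; rewrite /N in pN He hiA hiB.
have [eK|eK] := ltnP e K.
  have [B|B] := leqP (s + 2 * p) (J + K).
    apply: (@vtm_squarefree e p) => // m Hm.
    rewrite -(@sqf_word_vtm j m) -?(@sqf_word_vtm j (m + p)); try lia.
    by rewrite -/J H ?addnA //; lia.
  have [C|C] := leqP (s + p) (J + K).
    have := hiH (J + (K - p)).
    by rewrite (_ : J + _ + p = J + K) ?hiA; lia.
  have [D|D] := leqP 3 p.
    have := hiH (J + K).
    by rewrite (_ : J + K + p = J + (K + 3) + (p - 3)) ?hiA ?hiB; lia.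
  have := hiH (J + K.-1).
  by rewrite -addnA !hiA; lia.
have [B|B] := leqP (s + 2 * p) (J + (K + 3)).
  have p1 : p = 1 by lia.
  have Es' : s = N * j + K + (e - K) by rewrite Es /J; lia.
  have := H s; rewrite p1 Es' addn1 -addnS !sqf_word_code; try lia.
  have e2 : e - K < 2 by lia.
  by have /eqP := code_adjacent (sqf_word_lt6 j) e2; move=> E F; apply/E/F; lia.
have [C|C] := leqP (s + p) (J + (K + 3)).
  have := hiH (J + (K + 3 - p)).
  by rewrite (_ : J + _ + p = J + (K + 3) + 0) ?hiA ?hiB; lia.
have [D|D] := leqP p K.
  have := hiH (J + K.+2).
  by rewrite (_ : J + K.+2 + p = J + (K + 3) + p.-1) ?hiA ?hiB; lia.
have := hiH (J + (K + 3)); have := hiB p; have := hiB 0.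
by rewrite addn0; lia.
Qed.

Lemma sqf_word_squarefree : squarefree y.
Proof.
move=> s p; elim/ltn_ind: p s => p IH s p0 H.
have [q Eq] := sqf_word_long_period H (sqf_word_short_period p0 H).
rewrite Eq in p0 H IH; have [s' Hs'] := sqf_word_desubst H.
by apply: (IH q _ s') => //; move: p0; rewrite /N; nia.
Qed.

End Squarefree.

(** * A morphism from squarefree words to binary words *)

Definition block (a : nat) : seq bool :=
  map odd (nth [::] [::
    [:: 0;1;1;0;0;1;1;0;1;1;0;0;1;0;1;1;0;0;1;0;0;1;1;0;0;1];
    [:: 0;1;1;0;0;1;1;0;1;1;0;0;1;0;0;1;1;0;1;0;0;1;1;0;0;1];
    [:: 0;1;1;0;0;1;1;0;1;0;0;1;1;0;1;1;0;0;1;0;0;1;1;0;0;1];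
    [:: 0;1;1;0;0;1;1;0;1;0;0;1;1;0;0;1;0;0;1;1;0;1;1;0;0;1];
    [:: 0;1;1;0;0;1;1;0;1;0;0;1;0;1;1;0;1;0;0;1;1;0;1;0;0;1];
    [:: 0;1;1;0;0;1;1;0;1;0;0;1;0;1;1;0;0;1;0;1;1;0;1;0;0;1]] a).

Definition marker : seq bool := map odd [:: 0;1;1;0;0;1;1].

(* No run of [true] is longer than [r], and the run at the head not longer
   than [c], the number of letters [true] that are still permitted. *)
Fixpoint no_run r c (l : seq bool) : bool :=
  if l is b :: l' then
    if b then (if c is c'.+1 then no_run r c' l' else false) else no_run r r l'
  else true.

Lemma no_runP r c l e :
  no_run r c l -> c <= r -> e + r < size l ->
  exists2 i, e <= i <= e + r & nth true l i = false.
Proof.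
have H0 c' l' : no_run r c' l' -> c' < size l' ->
    exists2 i, i <= c' & nth true l' i = false.
  elim: l' c' => //= -[] l' IH c' H Hs; last by exists 0.
  case: c' H Hs => // c' H Hs.
  by have [i Hi Ei] := IH _ H Hs; exists i.+1.
elim: l c e => //= b l IH c [|e] H Hc Hs.
  have [i Hi Ei] := H0 c (b :: l) H (leq_ltn_trans Hc Hs).
  by exists i => //; lia.
have [c' [H' Hc']] : exists c', no_run r c' l /\ c' <= r.
  by case: b H => [|H]; [case: c Hc => // c Hc H; exists c; split=> //; lia | exists r].
have [i Hi Ei] := IH c' e H' Hc' Hs.
by exists i.+1.
Qed.

(** A run of [r] letters [true] is a factor of length [p + r] with period [p]. *)
Definition agree p (w : seq bool) : seq bool :=
  [seq u.1 == u.2 | u <- zip w (drop p w)].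

Lemma nth_agree p w i :
  i + p < size w -> nth true (agree p w) i = (nth false w i == nth false w (i + p)).
Proof.
move=> Hi; have Hs : i < size (zip w (drop p w)).
  by rewrite size_zip size_drop; lia.
rewrite (nth_map (false, false)) // nth_zip_cond Hs /= nth_drop.
by rewrite (addnC p).
Qed.

(** Its 85 letters suffice for periods below 26: a forbidden repetition shows within 25 + 33 + 1
    letters, after an offset of at most 25. *)
Definition word3 a b c := block a ++ block b ++ block c ++ marker.

Lemma size_block a : a < 6 -> size (block a) = 26.
Proof. by do 6 (case: a => [|a] //). Qed.

Lemma take_block a : a < 6 -> take 7 (block a) = marker.
Proof. by do 6 (case: a => [|a] //). Qed.

Lemma word3_no_run a b c p :
  a < 6 -> b < 6 -> c < 6 -> a != b -> b != c -> 0 < p < 26 ->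
  no_run (4 * p %/ 3) (4 * p %/ 3) (agree p (word3 a b c)).
Proof.
pose check := all (fun a => all (fun b => all (fun c =>
  (a == b) || (b == c) || all (fun p =>
    no_run (4 * p %/ 3) (4 * p %/ 3) (agree p (word3 a b c))) (iota 1 25))
  (iota 0 6)) (iota 0 6)) (iota 0 6).
have Hcheck : check by vm_compute.
move=> Ha Hb Hc /negPf ab /negPf bc Hp.
have /allP/(_ a) := Hcheck; rewrite mem_iota Ha => /(_ isT).
move/allP/(_ b); rewrite mem_iota Hb => /(_ isT).
move/allP/(_ c); rewrite mem_iota Hc ab bc => /(_ isT).
by move/allP/(_ p); apply; rewrite mem_iota; lia.
Qed.

Lemma marker_sync a f :
  a < 6 -> f < 26 -> take 7 (drop f (block a ++ marker)) = marker -> f = 0.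
Proof.
pose check := all (fun a => all (fun f =>
  (f == 0) || (take 7 (drop f (block a ++ marker)) != marker))
  (iota 0 26)) (iota 0 6).
have Hcheck : check by vm_compute.
move=> Ha Hf /eqP E; have /allP/(_ a) := Hcheck; rewrite mem_iota Ha => /(_ isT).
by move/allP/(_ f); rewrite mem_iota Hf E orbF => /(_ isT)/eqP.
Qed.

Lemma block_inj_prefix a b :
  a < 6 -> b < 6 -> take 17 (block a) = take 17 (block b) -> a = b.
Proof. by do 6 (case: a => [|a] //; first by do 6 (case: b => [|b] //)). Qed.

Lemma block_inj_suffix a b :
  a < 6 -> b < 6 -> drop 9 (block a) = drop 9 (block b) -> a = b.
Proof. by do 6 (case: a => [|a] //; first by do 6 (case: b => [|b] //)). Qed.

Definition block_word (y : nat -> nat) (n : nat) : bool :=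
  nth false (block (y (n %/ 26))) (n %% 26).

Section BlockWord.
Variable y : nat -> nat.
Hypotheses (y_lt6 : forall n, y n < 6) (y_sqf : squarefree y).
Let X := block_word y.

Let X_block j i : i < 26 -> X (26 * j + i) = nth false (block (y j)) i.
Proof.
by move=> Hi; rewrite /X /block_word mulnC divnMDl // modnMDl divn_small ?modn_small ?addn0.
Qed.

Let X_marker j i : i < 7 -> X (26 * j + i) = nth false marker i.
Proof.
by move=> Hi; rewrite X_block -?(take_block (y_lt6 j)) ?nth_take //; lia.
Qed.

Let X_block_marker j i : i < 33 -> X (26 * j + i) = nth false (block (y j) ++ marker) i.
Proof.
move=> Hi; rewrite nth_cat size_block //; case: ltnP => H; first exact: X_block.
by rewrite -(X_marker j.+1); [congr X; lia | lia].
Qed.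

Let X_word3 j i :
  i < 85 -> X (26 * j + i) = nth false (word3 (y j) (y j.+1) (y j.+2)) i.
Proof.
move=> Hi; rewrite /word3 nth_cat size_block //.
case: ltnP => H; first exact: X_block.
rewrite nth_cat size_block //; case: ltnP => H'.
  by rewrite -X_block //; congr X; lia.
by rewrite -X_block_marker; [congr X; lia | lia].
Qed.

Let y_adjacent n : y n != y n.+1.
Proof.
apply/eqP => E; apply: (y_sqf (s := n) (p := 1)) => // m Hm.
by rewrite (_ : m = n) ?addn1 //; lia.
Qed.

Lemma block_word_short_period s p r :
  0 < p < 26 -> matches X s p r -> 3 * r <= 4 * p.
Proof.
move=> Hp H; rewrite leqNgt; apply/negP => Hr.
have Es := divn_eq s 26; set j := s %/ 26 in Es; set e := s %% 26 in Es.
have He : e < 26 by rewrite ltn_mod.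
have Hno := word3_no_run (y_lt6 j) (y_lt6 j.+1) (y_lt6 j.+2)
  (y_adjacent _) (y_adjacent _) Hp.
have Hsz : size (word3 (y j) (y j.+1) (y j.+2)) = 85.
  by rewrite !size_cat !size_block.
have [|i Hi] := no_runP (e := e) Hno (leqnn _).
  by rewrite size_map size_zip size_drop Hsz; lia.
rewrite nth_agree -?X_word3 ?Hsz; try lia.
by rewrite addnA -H ?eqxx //; lia.
Qed.

(** A window of 33 letters contains the marker at the start of some block; the period carries it to
    another occurrence, which must also start a block. *)
Lemma block_word_sync s p r :
  33 <= r -> matches X s p r -> 26 %| p.
Proof.
move=> Hr H; pose j := (s + 25) %/ 26.
have Hj : s <= 26 * j < s + 26 by rewrite /j; lia.
have Ej := divn_eq (26 * j + p) 26; set j' := _ %/ 26 in Ej; set f := _ %% 26 in Ej.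
have Hf : f < 26 by rewrite ltn_mod.
suff f0 : f = 0 by rewrite -(dvdn_addr _ (dvdn_mulr j (dvdnn 26))) Ej f0 addn0 dvdn_mull.
apply: (@marker_sync (y j')) => //.
apply: (@eq_from_nth _ false) => [|i].
  by rewrite size_takel // size_drop size_cat size_block //=; lia.
rewrite size_takel; last by rewrite size_drop size_cat size_block //=; lia.
move=> Hi; rewrite nth_take // nth_drop -X_block_marker; last by lia.
rewrite -(X_marker j) // (H (26 * j + i)); last by lia.
by congr X; lia.
Qed.

Lemma block_word_long_period s q r :
  0 < q -> 104 * q < 3 * r -> ~ matches X s (26 * q) r.
Proof.
move=> q0 Hr H.
have Es := divn_eq s 26; set j := s %/ 26 in Es; set e := s %% 26 in Es.
have He : e < 26 by rewrite ltn_mod.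
have E n i : i < 26 -> s <= 26 * n + i < s + r ->
    nth false (block (y n)) i = nth false (block (y (n + q))) i.
  by move=> Hi Hn; rewrite -!X_block // H //; congr X; lia.
(* Here [r >= 26 * q + 9], so the window meets [q] consecutive blocks and their shifts in at least
   their last 17 letters ([e <= 9]) or their first 17, giving a square in [y]. *)
have [e9|e9] := leqP e 9.
  apply: (y_sqf (s := j) (p := q)) => // n Hn.
  apply: block_inj_suffix => //; apply: (@eq_from_nth _ false).
    by rewrite !size_drop !size_block.
  by move=> i; rewrite size_drop size_block // => Hi; rewrite !nth_drop E; lia.
apply: (y_sqf (s := j.+1) (p := q)) => // n Hn.
apply: block_inj_prefix => //; apply: (@eq_from_nth _ false).
  by rewrite !size_takel ?size_block.
move=> i; rewrite size_takel ?size_block // => Hi.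
by rewrite !nth_take // E; lia.
Qed.

Lemma block_word_exponent s p r :
  0 < p -> matches X s p r -> 3 * r <= 4 * p.
Proof.
move=> p0 H; have [p26|p26] := ltnP p 26.
  by apply: block_word_short_period H; rewrite p0.
rewrite leqNgt; apply/negP => Hr.
have r33 : 33 <= r by lia.
have /dvdnP[q Eq] := block_word_sync r33 H.
rewrite Eq mulnC in H; apply: block_word_long_period H; lia.
Qed.

End BlockWord.

(** * Automaticity of uniform images *)

Section UniformImage.
Variables (k L : nat) (A : Type) (T : finType).
Variables (z : nat -> T) (step : T -> 'I_k -> T) (out : T -> nat -> A).
Hypotheses (L_gt0 : 0 < L) (zE : forall n (d : 'I_k), z (n * k + d) = step (z n) d).

Let quotient_lt (r : 'I_L) (d : 'I_k) : (r * k + d) %/ L < k.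
Proof. by rewrite ltn_divLR //; have := ltn_ord r; have := ltn_ord d; nia. Qed.

(* Dividing by [L] with the most significant digit first, one only has to
   remember the current remainder. *)
Lemma automatic_uniform_image :
  @automatic k A (fun n => out (z (n %/ L)) (n %% L)).
Proof.
pose w n : T * 'I_L := (z (n %/ L), Ordinal (ltn_pmod n L_gt0)).
pose wstep (u : T * 'I_L) (d : 'I_k) : T * 'I_L :=
  (step u.1 (Ordinal (quotient_lt u.2 d)), Ordinal (ltn_pmod (u.2 * k + d) L_gt0)).
apply: (@automatic_of_step _ _ _ w wstep (fun u => out u.1 u.2)) => n d.
have E : n * k + d = n %/ L * k * L + (n %% L * k + d).
  by rewrite {1}(divn_eq n L); lia.
rewrite /w /wstep /= -zE; congr (z _, _).
  by rewrite /= {1}E divnMDl.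
by apply/val_inj; rewrite /= {1}E modnMDl.
Qed.

End UniformImage.

Section SquareUniform.
Variables (k : nat) (T : finType) (y : nat -> T) (h : T -> nat -> T).
Hypothesis yE : forall n r, r < k * k -> y (k * k * n + r) = h (y n) r.

Let square_state n : T * {ffun 'I_k -> T} := (y n, [ffun e : 'I_k => y (n * k + e)]).

Let square_step (u : T * {ffun 'I_k -> T}) (d : 'I_k) : T * {ffun 'I_k -> T} :=
  (u.2 d, [ffun e : 'I_k => h u.1 (d * k + e)]).

(* Remembering the letters at [n] and at [n k, ..., n k + k - 1] allows to read
   the base-[k ^ 2] digits of [n] one base-[k] digit at a time. *)
Lemma automatic_square_uniform (A : Type) L (out : T -> nat -> A) :
  0 < L -> @automatic k A (fun n => out (y (n %/ L)) (n %% L)).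
Proof.
move=> L0; apply: (@automatic_uniform_image _ _ _ _ square_state square_step
                     (fun u => out u.1)) => // n d.
rewrite /square_state /square_step /= ffunE; congr (_, _).
apply/ffunP => e; rewrite !ffunE -yE; first by congr y; lia.
by have := ltn_ord d; have := ltn_ord e; nia.
Qed.

End SquareUniform.

(** Block length [k * k] instead of [k] leaves a nonempty prefix before the codeword even for [k]
    equal to 2 or 3. *)
Lemma block_word_automatic k :
  1 < k -> @automatic k bool (block_word (sqf_word (k * k - 3))).
Proof.
move=> k1; set K := k * k - 3; have [K0 EK] : 0 < K /\ k * k = K + 3 by rewrite /K; nia.
have lt6 := sqf_word_lt6 K0.
pose y n : 'I_6 := inord (sqf_word K n).
have yE n : y n = sqf_word K n :> nat by rewrite inordK.
pose h (a : 'I_6) r : 'I_6 := inord (sqf_morphism K a r).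
have -> : block_word (sqf_word K) =
    fun n => nth false (block (y (n %/ 26))) (n %% 26).
  by apply/funext => n; rewrite /block_word yE.
apply: (@automatic_square_uniform k _ y h _ _ 26 (fun a r => nth false (block a) r)) => //.
move=> n r Hr; apply/val_inj; rewrite EK in Hr *.
rewrite /= !inordK //; first by rewrite sqf_wordE.
by apply: sqf_morphism_lt6.
Qed.

(* The values of the two thresholds *)
Local Close Scope nat_scope.

Lemma repetition_threshold_eq (R : realType) (S : set (nat -> bool)) (c : R) x :
  S x -> (critical_exponent R x <= c%:E)%E ->
  (forall x', S x' -> (c%:E <= critical_exponent R x')%E) ->
  repetition_threshold R S = c%:E.
Proof.
move=> Sx Hx Hle; apply/eqP; rewrite eq_le; apply/andP; split.
  by apply: ge_ereal_inf; exists (critical_exponent R x) => //; exists x.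
by apply: le_ereal_inf_tmp => _ [x' Sx' <-]; exact: Hle.
Qed.

Theorem theorem1 (R : realType) (k : nat) (hk : (2 <= k)%N) :
  ((exists m : nat, k = (2 ^ m)%N) ->
     repetition_threshold R (@automatic k bool) = (2 : R)%:E) /\
  (~ (exists m : nat, k = (2 ^ m)%N) ->
     repetition_threshold R (@automatic k bool) = (7 / 3 : R)%:E).
Proof.
split=> [[m ->]|Hk].
  apply: (repetition_threshold_eq (thue_morse_automatic m)).
    apply: critical_exponent_le => s p r p0 H; rewrite -natrM ler_nat.
    have [|rp] := leqP r p; first by lia.
    by case: (thue_morse_overlap_free p0 (matches_sub (leqnn s) _ H)); lia.
  by move=> x _; exact: critical_exponent_ge2.
have K0 : (0 < k * k - 3)%N by nia.
apply: (repetition_threshold_eq (block_word_automatic hk)).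
  apply: critical_exponent_le => s p r p0 H.
  have := block_word_exponent (sqf_word_lt6 K0) (sqf_word_squarefree K0) p0 H.
  rewrite -(ler_nat R) !natrM natrD; lra.
move=> x Hx; rewrite leNgt; apply/negP => /lt73_free_of_critical_exponent.
by move/(automatic_lt73_free hk Hx).
Qed.
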